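(* Every nonempty DSF set contains a complete bipartite graph (possibly with an empty part) and a disjoint union of complete graphs in which at most one component has more than two vertices. Moreover, every nonempty DSF set also contains a disjoint union of at most two complete graphs and a complete multipartite graph in which at most one partite set has more than two vertices.
   Context: All graphs are finite and simple, considered up to isomorphism. For a set $\mathcal{F}$ of graphs, a graph is $\mathcal{F}$-free if none of its induced subgraphs is isomorphic to a member of $\mathcal{F}$. A set $\mathcal{F}$ of graphs is degree-sequence-forcing (DSF) if whenever some realization of a degree sequence $d$ (a graph with degree sequence $d$) is $\mathcal{F}$-free, every realization of $d$ is $\mathcal{F}$-free. ''Contains'' here means ''has as an element''. *)

(* Defs.v *)
From HB Require Import structures.
From mathcomp Require Import all_boot.

Set Implicit Arguments.
Unset Strict Implicit.
Unset Printing Implicit Defensive.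

(* The graph with no vertices is allowed. *)
Record sgraph := SGraph {
  vertex :> finType;
  adj : rel vertex;
  adj_sym : symmetric adj;
  adj_irrefl : irreflexive adj
}.

Definition iso (G H : sgraph) : Prop :=
  exists f : G -> H, bijective f /\ forall x y, adj (f x) (f y) = adj x y.

Section Induced.
Variables (G : sgraph) (S : {set G}).

Definition induced_adj : rel {x : G | x \in S} :=
  [rel x y | adj (val x) (val y)].

Lemma induced_adj_sym : symmetric induced_adj.
Proof. by move=> x y; exact: adj_sym. Qed.

Lemma induced_adj_irrefl : irreflexive induced_adj.
Proof. by move=> x; exact: adj_irrefl. Qed.

Definition induced : sgraph := SGraph induced_adj_sym induced_adj_irrefl.
End Induced.

(* A set of graphs is an arbitrary predicate on sgraph, not necessarily closed
   under isomorphism: it is only ever tested up to isomorphism below. *)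
Definition free (F : sgraph -> Prop) (G : sgraph) : Prop :=
  forall (S : {set G}) (H : sgraph), F H -> ~ iso (induced S) H.

Definition deg (G : sgraph) (x : G) : nat := #|[set y | adj x y]|.

Definition degree_sequence (G : sgraph) : seq nat :=
  sort geq [seq deg x | x <- enum G].

Definition realization (d : seq nat) (G : sgraph) : Prop :=
  degree_sequence G = d.

Definition DSF (F : sgraph -> Prop) : Prop :=
  forall d : seq nat,
    (exists G, realization d G /\ free F G) ->
    forall G, realization d G -> free F G.

(* The parts are A and its complement; either may be empty. *)
Definition complete_bipartite (G : sgraph) : Prop :=
  exists A : {set G}, forall x y : G, adj x y = ((x \in A) != (y \in A)).

(* The blocks of P, nonempty by definition of partition, are the vertex sets of
   the complete graphs, i.e. the components of G. *)
Definition complete_union (G : sgraph) (P : {set {set G}}) : Prop :=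
  partition P [set: G] /\
  forall x y : G, adj x y = (x != y) && (pblock P x == pblock P y).

Definition complete_multipartite (G : sgraph) (P : {set {set G}}) : Prop :=
  partition P [set: G] /\
  forall x y : G, adj x y = (pblock P x != pblock P y).

Definition at_most_one_large (T : finType) (P : {set {set T}}) : Prop :=
  #|[set B in P | 2 < #|B|]| <= 1.

(* Main.v *)
Require Import Defs.
From mathcomp Require Import all_boot.
From Stdlib Require Import Classical.

Set Implicit Arguments.
Unset Strict Implicit.
Unset Printing Implicit Defensive.

(** If [H] and [H'] have the same degree sequence and [H] contains a member of
    a DSF set [F] as an induced subgraph, then so does [H'].  The four classes
    of the theorem are hereditary, so a class [C] meets every nonempty DSF set
    as soon as an arbitrary graph [G] is an induced subgraph of some [H] with
    the degree sequence of a member [H'] of [C].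

    For complete bipartite graphs, [H] consists of two copies of [G], with
    vertices of different copies adjacent when they are not adjacent in [G];
    it is [n]-regular on [2n] vertices, like [K_{n,n}].  For disjoint unions of
    complete graphs, [H] is [G] with a pendant vertex attached to [u] for each
    ordered nonadjacent pair [(u, v)]; it has the degrees of the graph in
    which [G] is completed and the pendant vertices of [(u, v)] and [(v, u)]
    are matched.  The other two classes are obtained by complementation. *)

Definition embeds (G H : sgraph) : Prop :=
  exists2 f : G -> H, injective f & forall x y, adj (f x) (f y) = adj x y.

Lemma embeds_trans (G H K : sgraph) : embeds G H -> embeds H K -> embeds G K.
Proof.
move=> [f f_inj f_adj] [g g_inj g_adj].
by exists (g \o f) => [|x y]; [exact: inj_comp | rewrite /= g_adj].
Qed.

Lemma embedsP (G H : sgraph) :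
  embeds G H <-> exists S : {set H}, iso (induced S) G.
Proof.
split=> [[f f_inj f_adj]|[S [f [[g fK gK] f_adj]]]].
  pose S := f @: [set: G].
  pose g (x : G) : induced S := exist _ (f x) (imset_f f (in_setT x)).
  have [h gK hK] : bijective g.
    apply: inj_card_bij => [x y [] /f_inj //|].
    by rewrite card_sig card_imset ?cardsT.
  exists S, h; split; first by exists g.
  by move=> x y; rewrite -f_adj -{2}[x]hK -{2}[y]hK.
exists (val \o g) => [|x y].
  by apply: inj_comp; [exact: val_inj | exact: can_inj gK].
by rewrite -[in RHS](gK x) -[in RHS](gK y) f_adj.
Qed.

Lemma not_freeP (F : sgraph -> Prop) (H : sgraph) :
  ~ free F H <-> exists2 K, F K & embeds K H.
Proof.
split=> [F_in_H|[K FK /embedsP[S S_K]] /(_ S K FK)]; last exact.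
apply: NNPP => F_avoids_H; apply: F_in_H => S K FK S_K.
by apply: F_avoids_H; exists K => //; apply/embedsP; exists S.
Qed.

Definition hereditary (C : sgraph -> Prop) : Prop :=
  forall G H, embeds G H -> C H -> C G.

Definition degree_unavoidable (C : sgraph -> Prop) : Prop :=
  forall G, exists H H',
    [/\ embeds G H, degree_sequence H = degree_sequence H' & C H'].

Lemma DSF_meets (F C : sgraph -> Prop) :
    DSF F -> (exists G, F G) -> hereditary C -> degree_unavoidable C ->
  exists G, F G /\ C G.
Proof.
move=> F_DSF [G FG] C_her /(_ G)[H [H' [G_H deg_HH' CH']]].
have /not_freeP[K FK K_H'] : ~ free F H'.
  move=> H'_free; have [//|] := (not_freeP F H).2; first by exists G.
  by apply: (F_DSF (degree_sequence H)) => //; exists H'.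
by exists K; split=> //; apply: C_her CH'.
Qed.

Lemma degree_sequence_eqP (G H : sgraph) :
  reflect (degree_sequence G = degree_sequence H)
    (perm_eq [seq deg x | x <- enum G] [seq deg x | x <- enum H]).
Proof.
apply: perm_sortP => [m n|m n p le_mn le_pm|m n].
- exact: leq_total.
- exact: leq_trans le_pm le_mn.
- by rewrite andbC => /anti_leq.
Qed.

Lemma eq_degree_sequence (G H : sgraph) (f : G -> H) :
    bijective f -> (forall x, deg (f x) = deg x) ->
  degree_sequence G = degree_sequence H.
Proof.
move=> f_bij f_deg; apply/degree_sequence_eqP.
rewrite -(eq_map f_deg) (map_comp (@deg H) f).
apply/perm_map/uniq_perm; rewrite ?enum_uniq //.
  by rewrite map_inj_uniq ?enum_uniq //; exact: bij_inj.
have [g _ gK] := f_bij.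
by move=> y; rewrite mem_enum -[y]gK map_f // mem_enum.
Qed.

Section Complement.
Variable G : sgraph.

Definition compl_adj (x y : G) : bool := (x != y) && ~~ adj x y.
Arguments compl_adj _ _ /.

Lemma compl_adj_sym : symmetric compl_adj.
Proof. by move=> x y /=; rewrite eq_sym adj_sym. Qed.

Lemma compl_adj_irrefl : irreflexive compl_adj.
Proof. by move=> x /=; rewrite eqxx. Qed.

Definition compl : sgraph := SGraph compl_adj_sym compl_adj_irrefl.

Lemma deg_compl (x : G) : @deg compl x = #|G| - (deg x).+1.
Proof.
rewrite /deg [LHS]cardsCs; congr (_ - _).
rewrite (_ : ~: _ = x |: [set y | adj x y]); last first.
  by apply/setP => y; rewrite !inE /= negb_and !negbK [y == x]eq_sym.
by rewrite cardsU1 inE adj_irrefl.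
Qed.
End Complement.
Arguments compl_adj _ _ _ /.

Lemma adj_complK (G : sgraph) (x y : G) :
  @adj (compl (compl G)) x y = adj x y.
Proof. by rewrite /=; case: eqVneq => [->|_]; rewrite ?adj_irrefl ?negbK. Qed.

Lemma embeds_compl (G H : sgraph) : embeds G H -> embeds (compl G) (compl H).
Proof.
move=> [f f_inj f_adj].
by exists f => // x y; rewrite /= f_adj (inj_eq f_inj).
Qed.

Lemma degree_sequence_compl (G H : sgraph) :
    degree_sequence G = degree_sequence H ->
  degree_sequence (compl G) = degree_sequence (compl H).
Proof.
move=> /degree_sequence_eqP perm_GH; apply/degree_sequence_eqP.
have eq_card : #|G| = #|H|.
  by rewrite !cardT -(size_map (@deg G)) (perm_size perm_GH) size_map.
rewrite (eq_map (@deg_compl G)) (eq_map (@deg_compl H)) eq_card.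
by have:= perm_map (fun d => #|H| - d.+1) perm_GH; rewrite -!map_comp.
Qed.

Lemma hereditary_compl (C : sgraph -> Prop) :
  hereditary C -> hereditary (fun G => C (compl G)).
Proof. by move=> C_her G H /embeds_compl; exact: C_her. Qed.

Lemma degree_unavoidable_compl (C : sgraph -> Prop) :
    hereditary C -> degree_unavoidable C ->
  degree_unavoidable (fun G => C (compl G)).
Proof.
move=> C_her C_unav G; have [H [H' [G_H deg_HH' CH']]] := C_unav (compl G).
exists (compl H), (compl H'); split; last 2 first.
- exact: degree_sequence_compl.
- by apply: C_her CH'; exists id => // x y; rewrite -adj_complK.
apply: embeds_trans (embeds_compl G_H).
by exists id => // x y; rewrite adj_complK.
Qed.

Lemma DSF_meets_compl (F C : sgraph -> Prop) :
    DSF F -> (exists G, F G) -> hereditary C -> degree_unavoidable C ->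
  exists G, F G /\ C (compl G).
Proof.
move=> F_DSF F_nonempty C_her C_unav; apply: DSF_meets => //.
  exact: hereditary_compl.
exact: degree_unavoidable_compl.
Qed.

Lemma pblock_preim_partition (T : finType) (L : eqType) (c : T -> L)
    (D : {set T}) (P := preim_partition c D) :
  {in D &, forall x y, (pblock P x == pblock P y) = (c x == c y)}.
Proof.
have /and3P[/eqP cover_P trivial_P _] : partition P D := preim_partitionP c D.
move=> x y Dx Dy; rewrite eq_pblock ?cover_P // pblock_equivalence_partition //.
by move=> u v w _ _ _; split=> // /eqP->.
Qed.

Lemma leq_card_preim_partition (T L : finType) (c : T -> L) (D : {set T}) :
  #|preim_partition c D| <= #|L|.
Proof.
apply: leq_trans (leq_imset_card (fun l => [set y in D | l == c y]) L).
by apply/subset_leq_card/subsetP => _ /imsetP[x _ ->]; exact: imset_f.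
Qed.

Lemma at_most_one_large_preim_partition (T : finType) (L : eqType)
    (c : T -> L) :
    {in [pred x | 2 < #|[set y | c y == c x]|] &, forall x y, c x = c y} ->
  at_most_one_large (preim_partition c [set: T]).
Proof.
have fibreE x : [set y in [set: T] | c x == c y] = [set y | c y == c x].
  by apply/setP => y; rewrite !inE eq_sym.
move=> large_eq; apply/card_le1_eqP => A B; rewrite !inE.
move=> /andP[/imsetP[x _ ->]]; rewrite fibreE => large_x.
move=> /andP[/imsetP[y _ ->]]; rewrite fibreE => large_y.
by rewrite (large_eq y x).
Qed.

Lemma complete_union_preim_partition (G : sgraph) (L : eqType) (c : G -> L) :
    (forall x y, adj x y = (x != y) && (c x == c y)) ->
  complete_union (preim_partition c [set: G]).
Proof.
move=> c_adj; split; first exact: preim_partitionP.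
by move=> x y; rewrite pblock_preim_partition ?inE // c_adj.
Qed.

Lemma complete_union_compl (G : sgraph) (P : {set {set G}}) :
  @complete_union (compl G) P -> complete_multipartite P.
Proof.
move=> [partition_P adj_P]; split=> // x y.
rewrite -adj_complK /= [_ && ~~ adj _ _]adj_P.
by case: eqVneq => [->|_]; rewrite ?eqxx.
Qed.

Lemma complete_bipartite_compl (G : sgraph) :
    complete_bipartite (compl G) ->
  exists P : {set {set G}}, complete_union P /\ #|P| <= 2.
Proof.
move=> [A A_adj]; exists (preim_partition (mem A) [set: G]); split.
  apply: complete_union_preim_partition => x y.
  by rewrite -adj_complK /= [_ && ~~ adj _ _]A_adj negbK.
by rewrite -card_bool leq_card_preim_partition.
Qed.

Lemma complete_bipartite_hereditary : hereditary complete_bipartite.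
Proof.
move=> G H [f _ f_adj] [A A_adj]; exists (f @^-1: A) => x y.
by rewrite -f_adj A_adj !inE.
Qed.

Definition one_large_union (G : sgraph) : Prop :=
  exists P : {set {set G}}, complete_union P /\ at_most_one_large P.

Lemma one_large_union_hereditary : hereditary one_large_union.
Proof.
move=> G H [f f_inj f_adj] [P [[partition_P adj_P] /card_le1_eqP large_eq]].
have /and3P[/eqP cover_P _ _] := partition_P.
pose c x := pblock P (f x); exists (preim_partition c [set: G]); split.
  apply: complete_union_preim_partition => x y.
  by rewrite -f_adj adj_P (inj_eq f_inj).
suff large_block x : 2 < #|[set y | c y == c x]| ->
    c x \in [set B in P | 2 < #|B|].
  apply: at_most_one_large_preim_partition => x y.
  by move=> /large_block large_x /large_block large_y; exact: large_eq.
rewrite inE pblock_mem ?cover_P //= => /leq_trans-> //.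
rewrite -(card_imset _ f_inj); apply/subset_leq_card/subsetP => z.
by case/imsetP=> y; rewrite inE => /eqP<- ->; rewrite mem_pblock cover_P.
Qed.

Section LabelledGraphs.
Variables (T : finType) (L : eqType) (c : T -> L).

Definition multipartite_adj (x y : T) : bool := c x != c y.
Arguments multipartite_adj _ _ /.

Lemma multipartite_adj_sym : symmetric multipartite_adj.
Proof. by move=> x y /=; rewrite eq_sym. Qed.

Lemma multipartite_adj_irrefl : irreflexive multipartite_adj.
Proof. by move=> x /=; rewrite eqxx. Qed.

Definition multipartite_graph : sgraph :=
  SGraph multipartite_adj_sym multipartite_adj_irrefl.

Definition union_adj (x y : T) : bool := (x != y) && (c x == c y).
Arguments union_adj _ _ /.

Lemma union_adj_sym : symmetric union_adj.
Proof. by move=> x y /=; rewrite eq_sym [c x == _]eq_sym. Qed.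

Lemma union_adj_irrefl : irreflexive union_adj.
Proof. by move=> x /=; rewrite eqxx. Qed.

Definition union_graph : sgraph := SGraph union_adj_sym union_adj_irrefl.
End LabelledGraphs.
Arguments multipartite_adj _ _ _ _ _ /.
Arguments union_adj _ _ _ _ _ /.

Lemma deg_imset (G : sgraph) (x : G) (T : finType) (A : {set T}) (f : T -> G) :
    {in A &, injective f} -> (forall y, adj x y = (y \in f @: A)) ->
  deg x = #|A|.
Proof.
move=> f_inj f_adj; rewrite /deg -(card_in_imset f_inj).
by apply: eq_card => y; rewrite inE f_adj.
Qed.

Section Double.
Variable G : sgraph.

Definition double_adj (x y : G * bool) : bool :=
  (x.2 == y.2) == adj x.1 y.1.
Arguments double_adj _ _ /.

Lemma double_adj_sym : symmetric double_adj.
Proof. by move=> x y /=; rewrite adj_sym [x.2 == _]eq_sym. Qed.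

Lemma double_adj_irrefl : irreflexive double_adj.
Proof. by move=> x /=; rewrite adj_irrefl eqxx. Qed.

Definition double : sgraph := SGraph double_adj_sym double_adj_irrefl.

Definition biclique : sgraph := multipartite_graph (@snd G bool).

Lemma deg_double (x : double) : deg x = #|G|.
Proof.
rewrite -cardsT; case: x => u i.
apply: (@deg_imset double _ _ _ (fun v : G => (v, i == adj u v))).
  by move=> v w _ _ [].
move=> [v j]; apply/eqP/imsetP => /= [eq_adj|[w _ [-> ->]]].
  by exists v; rewrite // -eq_adj; case: i j {eq_adj} => [] [].
by case: i; case: adj.
Qed.

Lemma deg_biclique (x : biclique) : deg x = #|G|.
Proof.
rewrite -cardsT; case: x => u i.
apply: (@deg_imset biclique _ _ _ (fun v : G => (v, ~~ i))).
  by move=> v w _ _ [].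
move=> [v j]; apply/idP/imsetP => /= [neq_ij|[w _ [_ ->]]]; last by case: i.
by exists v => //; case: i j neq_ij => [] [].
Qed.
End Double.

Lemma complete_bipartite_unavoidable : degree_unavoidable complete_bipartite.
Proof.
move=> G; exists (double G), (biclique G); split.
- by exists (fun x => (x, false)) => [x y []|].
- apply: (@eq_degree_sequence (double G) (biclique G) id) => [|x].
    by exists id.
  by rewrite deg_double deg_biclique.
- by exists [set x | x.2] => x y; rewrite !inE.
Qed.

Section Pendant.
Variable G : sgraph.

Definition nonedge : finType := {p : G * G | @adj (compl G) p.1 p.2}.

Lemma adj_flip (p : nonedge) : @adj (compl G) (val p).2 (val p).1.
Proof. by rewrite adj_sym (valP p). Qed.

Definition flip (p : nonedge) : nonedge :=
  Sub ((val p).2, (val p).1) (adj_flip p).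

Lemma flip_neq (p : nonedge) : (p == flip p) = false.
Proof.
have /andP[/negPf neq_ends _] := valP p.
by rewrite -val_eqE /= [val p]surjective_pairing xpair_eqE neq_ends.
Qed.

Definition ends (p : nonedge) : {set G} := [set (val p).1; (val p).2].

Lemma eq_ends (p q : nonedge) : (ends p == ends q) = (q == p) || (q == flip p).
Proof.
case: p q => [[a b] /= adj_ab] [[a' b'] /= adj_ab'].
have /andP[/negPf neq_ab _] := adj_ab; have /andP[/negPf neq_ab' _] := adj_ab'.
rewrite eqEsubset !subUset !sub1set !inE -!val_eqE /= !xpair_eqE.
rewrite [a == a']eq_sym [a == b']eq_sym [b == a']eq_sym [b == b']eq_sym.
case: (eqVneq a' a) neq_ab' => [->|_] neq_ab';
  case: (eqVneq b' b) neq_ab' => [->|_] neq_ab'.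
all: by rewrite ?neq_ab ?neq_ab' //=; do !case: (_ == _).
Qed.

Definition pendant_adj : rel (G + nonedge) := fun x y =>
  match x, y with
  | inl u, inl v => adj u v
  | inl u, inr p | inr p, inl u => (val p).1 == u
  | inr _, inr _ => false
  end.

Lemma pendant_adj_sym : symmetric pendant_adj.
Proof. by move=> [u|p] [v|q] //=; rewrite adj_sym. Qed.

Lemma pendant_adj_irrefl : irreflexive pendant_adj.
Proof. by move=> [u|p] //=; rewrite adj_irrefl. Qed.

Definition pendant : sgraph := SGraph pendant_adj_sym pendant_adj_irrefl.

Definition matched_label (x : G + nonedge) : option {set G} :=
  if x is inr p then Some (ends p) else None.

Definition matched : sgraph := union_graph matched_label.

(* The neighbours of [u] are indexed by the other vertices [v] of [G]: [v]
   itself if it is adjacent to [u], the pendant vertex of [(u, v)] if not. *)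
Lemma deg_pendant_inl (u : G) : @deg pendant (inl u) = #|G|.-1.
Proof.
pose neighbour v : pendant :=
  if @insub _ _ nonedge (u, v) is Some p then inr p else inl v.
rewrite -(cardsC1 u); apply: (@deg_imset pendant _ _ _ neighbour).
  move=> v w _ _; rewrite /neighbour.
  case: insubP => [p _ p_uv|_]; case: insubP => [q _ q_uw|_] // [] // pq.
  by move: q_uw; rewrite -pq p_uv => -[].
move=> [v|p]; apply/idP/imsetP => /= [adj_u|[w]].
- exists v; last by rewrite /neighbour insubN //= adj_u andbF.
  by rewrite !inE; apply: contraTneq adj_u => ->; rewrite adj_irrefl.
- rewrite !inE /neighbour => neq_wu; case: insubP => //= adj_uw [->].
  by rewrite eq_sym neq_wu negbK in adj_uw.
- have /andP[neq_p _] := valP p; rewrite (eqP adj_u) in neq_p.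
  exists (val p).2; first by rewrite !inE eq_sym.
  by rewrite /neighbour -(eqP adj_u) -surjective_pairing valK.
- by rewrite /neighbour; case: insubP => //= q _ q_uw _ [->]; rewrite q_uw.
Qed.

Lemma deg_matched_inl (u : G) : @deg matched (inl u) = #|G|.-1.
Proof.
rewrite -(cardsC1 u); apply: (@deg_imset matched _ _ _ inl) => [v w _ _ []//|].
move=> [v|p] /=; last by apply/esym/imsetP => -[].
by rewrite (mem_imset _ _ inl_inj) !inE andbT eq_sym.
Qed.

Lemma deg_pendant_inr (p : nonedge) : @deg pendant (inr p) = 1.
Proof.
apply/eqP/cards1P; exists (inl (val p).1); apply/setP => -[u|q].
  by rewrite !inE /= eq_sym.
by rewrite !inE.
Qed.

Lemma deg_matched_inr (p : nonedge) : @deg matched (inr p) = 1.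
Proof.
apply/eqP/cards1P; exists (inr (flip p)).
apply/setP => -[u|q]; rewrite !inE //=.
rewrite !(inj_eq inr_inj) (inj_eq Some_inj) eq_ends eq_sym.
by case: eqVneq => [->|_] //=; rewrite flip_neq.
Qed.

Lemma matched_label_large (x : G + nonedge) :
  2 < #|[set y | matched_label y == matched_label x]| -> matched_label x = None.
Proof.
case: x => [//|p]; rewrite ltnNge => /negP[].
have : #|[set (inr p : matched); inr (flip p)]| <= 2.
  by rewrite cards2; case: (_ == _).
apply: leq_trans; apply/subset_leq_card/subsetP => -[u|q]; rewrite !inE //.
by rewrite !(inj_eq inr_inj) (inj_eq Some_inj) eq_sym eq_ends.
Qed.
End Pendant.

Lemma one_large_union_unavoidable : degree_unavoidable one_large_union.
Proof.
move=> G; exists (pendant G), (matched G); split.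
- by exists inl => [x y []|].
- apply: (@eq_degree_sequence (pendant G) (matched G) id); first by exists id.
  move=> [u|p]; first by rewrite deg_pendant_inl deg_matched_inl.
  by rewrite deg_pendant_inr deg_matched_inr.
- exists (preim_partition (@matched_label G) [set: matched G]); split.
    exact: complete_union_preim_partition.
  apply: at_most_one_large_preim_partition => x y.
  by move=> /matched_label_large-> /matched_label_large->.
Qed.

Theorem theorem3p2 (F : sgraph -> Prop) (F_nonempty : exists G : sgraph, F G)
    (F_DSF : DSF F) :
  ((exists G : sgraph, F G /\ complete_bipartite G) /\
   (exists G : sgraph, F G /\
      exists P : {set {set G}}, complete_union P /\ at_most_one_large P)) /\
  ((exists G : sgraph, F G /\
      exists P : {set {set G}}, complete_union P /\ #|P| <= 2) /\
   (exists G : sgraph, F G /\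
      exists P : {set {set G}},
        complete_multipartite P /\ at_most_one_large P)).
Proof.
split; split.
- exact: DSF_meets complete_bipartite_hereditary complete_bipartite_unavoidable.
- exact: DSF_meets one_large_union_hereditary one_large_union_unavoidable.
- have [G [FG bipartite_coG]] := DSF_meets_compl F_DSF F_nonempty
    complete_bipartite_hereditary complete_bipartite_unavoidable.
  by exists G; split=> //; exact: complete_bipartite_compl.
- have [G [FG [P [union_P large_P]]]] := DSF_meets_compl F_DSF F_nonempty
    one_large_union_hereditary one_large_union_unavoidable.
  by exists G; split=> //; exists P; split=> //; exact: complete_union_compl.
Qed.
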